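(* Let $\mathcal U$ be the uniform distribution on the $n$-qubit Clifford group $\mathrm{Cl}_n$, let $\rho$ be a density operator and $O$ a traceless Hermitian operator on $\mathcal H$. Then $$V_*(O,\rho)=V_\triangle(O,\rho)-\frac{[\operatorname{tr}(O\rho)]^2}{d+2}\le V_\triangle(O,\rho)\le\frac{2(d+1)}{d(d+2)}\|\Xi_{\rho,O}\|_2^2\le\frac{2(d+1)}{d+2}\|O\|_2^2.$$
   Context: Let $n\ge1$, $d=2^n$, $\mathcal H=(\mathbb C^2)^{\otimes n}$ with computational basis $\{|\mathbf b\rangle\}$. For a unitary ensemble $\mathcal U$ (probability distribution on $U(d)$) with measurement channel $\mathcal M(X)=\mathbb E_{U}\sum_{\mathbf b}\langle\mathbf b|UXU^\dagger|\mathbf b\rangle U^\dagger|\mathbf b\rangle\langle\mathbf b|U$ (for a 2-design, $\mathcal M^{-1}(O)=(d+1)O-\operatorname{tr}(O)\mathbb 1$), define for a density operator $\rho$ and traceless Hermitian $O$: $V_*(O,\rho)=\mathbb E_{U}\bigl(\sum_{\mathbf b}\langle\mathbf b|U\rho U^\dagger|\mathbf b\rangle\langle\mathbf b|U\mathcal M^{-1}(O)U^\dagger|\mathbf b\rangle\bigr)^2-[\operatorname{tr}(O\rho)]^2$. The Clifford group $\mathrm{Cl}_n$ is the group of unitaries $U$ with $U\mathcal P_nU^\dagger=\mathcal P_n$, where $\mathcal P_n$ is the $n$-qubit Pauli group (finite modulo phases; phases are irrelevant here). Let $\overline{\mathcal P}_n=\{I,X,Y,Z\}^{\otimes n}$ ($d^2$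 operators). For operators $A,B$ define functions on $\overline{\mathcal P}_n$: $\Xi_A(P)=\operatorname{tr}(AP)$, $\Xi_{A,B}(P)=\operatorname{tr}(AP)\operatorname{tr}(BP)$, $\tilde\Xi_{A,B}(P)=\operatorname{tr}(APBP)$, viewed as vectors in $\mathbb R^{d^2}$ with $\ell_p$ norms $\|\cdot\|_p$ and inner product $\cdot$. Define $V_\triangle(O,\rho)=\frac{d+1}{d(d+2)}\bigl(\|\Xi_{\rho,O}\|_2^2+\tilde\Xi_{\rho,O}\cdot\Xi_{\rho,O}\bigr)$. $\|O\|_2$ is the Hilbert–Schmidt norm. *)

(* Defs.v *)
(* Scalars: C (algebraic complex numbers, a numClosedFieldType). *)
From HB Require Import structures.
From mathcomp Require Import all_boot all_order all_algebra.
Set Implicit Arguments. Unset Strict Implicit. Unset Printing Implicit Defensive.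
Import Order.TTheory GRing.Theory Num.Theory.
Local Open Scope ring_scope.

(* Dimension d = 2^n; operators on H = (C^2)^{(x)n} are 'M[C]_(2^n).  The
   computational basis vector |b> is the basis vector of index b : 'I_(2^n);
   the k-th qubit of b is bit k of the binary expansion of b. *)

(** conjugate transpose *)
Definition adjmx {C : numClosedFieldType} (m : nat) (A : 'M[C]_m) : 'M[C]_m :=
  \matrix_(i, j) (A j i)^*.

Definition herm_op {C : numClosedFieldType} (m : nat) (A : 'M[C]_m) : Prop := adjmx A = A.

Definition unitary {C : numClosedFieldType} (m : nat) (U : 'M[C]_m) : Prop := U *m adjmx U = 1%:M.

(** positive semidefinite: <v|A|v> >= 0 for every vector v *)
Definition psd {C : numClosedFieldType} (m : nat) (A : 'M[C]_m) : Prop :=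
  forall v : 'cV[C]_m, 0 <= ((\row_i (v i 0)^*) *m A *m v) 0 0.

(** density operator *)
Definition density {C : numClosedFieldType} (m : nat) (rho : 'M[C]_m) : Prop :=
  herm_op rho /\ psd rho /\ \tr rho = 1.

(** single-qubit Paulis I, X, Y, Z indexed by 0,1,2,3; entry <a|s|b>, a b bits *)
Definition pauli1 {C : numClosedFieldType} (s : 'I_4) (a b : bool) : C :=
  match val s with
  | 0 => if a == b then 1 else 0                             (* I *)
  | 1 => if a == b then 0 else 1                             (* X *)
  | 2 => if a == b then 0 else (if a then 'i else - 'i)      (* Y = [[0,-i],[i,0]] *)
  | _ => if a == b then (if a then -1 else 1) else 0         (* Z *)
  end.

(** bit k of the index i *)
Definition bit (k i : nat) : bool := odd (i %/ 2 ^ k).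

(** the n-qubit Pauli strings: Pbar_n = {I,X,Y,Z}^{(x)n}, indexed by sigma *)
Definition pstring (n : nat) := {ffun 'I_n -> 'I_4}.

(** tensor product P_{sigma_0} (x) ... (x) P_{sigma_{n-1}}, written entrywise *)
Definition pauli {C : numClosedFieldType} (n : nat) (sigma : pstring n) : 'M[C]_(2 ^ n) :=
  \matrix_(i, j) \prod_(k < n) pauli1 (sigma k) (bit k i) (bit k j).

(** the Pauli group P_n = { i^k P | P in Pbar_n } *)
Definition in_pauli_group {C : numClosedFieldType} (n : nat) (M : 'M[C]_(2 ^ n)) : Prop :=
  exists (k : nat) (sigma : pstring n), M = ('i ^+ k) *: pauli sigma.

(** Clifford group: unitaries U with U P_n U^dagger = P_n *)
Definition clifford {C : numClosedFieldType} (n : nat) (U : 'M[C]_(2 ^ n)) : Prop :=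
  unitary U /\
  forall M : 'M[C]_(2 ^ n),
    in_pauli_group M <-> in_pauli_group (U *m M *m adjmx U).

(** U and V agree up to a global phase *)
Definition phase_equiv {C : numClosedFieldType} (m : nat) (U V : 'M[C]_m) : Prop :=
  exists c : C, `|c| = 1 /\ V = c *: U.

(** s is a transversal of Cl_n modulo phases: every element of s is Clifford and
    every Clifford is phase-equivalent to exactly one entry of s.  The uniform
    distribution on Cl_n (phases being irrelevant) is the uniform distribution
    on the entries of s. *)
Definition clifford_transversal {C : numClosedFieldType} (n : nat) (s : seq 'M[C]_(2 ^ n)) : Prop :=
  (forall U, U \in s -> clifford U) /\
  forall U, clifford U -> exists! i : 'I_(size s), phase_equiv U (nth 0 s i).

(** expectation over the uniform distribution on s *)
Definition expect {C : numClosedFieldType} (m : nat) (s : seq 'M[C]_m) (f : 'M[C]_m -> C) : C :=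
  (size s)%:R^-1 * \sum_(U <- s) f U.

Definition expectM {C : numClosedFieldType} (m : nat) (s : seq 'M[C]_m)
    (f : 'M[C]_m -> 'M[C]_m) : 'M[C]_m :=
  (size s)%:R^-1 *: \sum_(U <- s) f U.

(** measurement channel M(X) = E_U sum_b <b|U X U^+|b> U^+ |b><b| U *)
Definition meas_channel {C : numClosedFieldType} (m : nat) (s : seq 'M[C]_m) (X : 'M[C]_m) : 'M[C]_m :=
  expectM s (fun U => \sum_(b < m)
     ((U *m X *m adjmx U) b b) *: (adjmx U *m delta_mx b b *m U)).

(** the 2-design formula M^{-1}(O) = (d+1) O - tr(O) 1 *)
Definition minv2 {C : numClosedFieldType} (m : nat) (O : 'M[C]_m) : 'M[C]_m :=
  (m.+1)%:R *: O - (\tr O) *: 1%:M.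

(** V_*(O, rho) *)
Definition Vstar {C : numClosedFieldType} (m : nat) (s : seq 'M[C]_m) (O rho : 'M[C]_m) : C :=
  expect s (fun U => (\sum_(b < m)
        (U *m rho *m adjmx U) b b * (U *m minv2 O *m adjmx U) b b) ^+ 2)
  - (\tr (O *m rho)) ^+ 2.

(** Xi_{A,B}(P) = tr(AP) tr(BP),  tilde Xi_{A,B}(P) = tr(APBP) *)
Definition Xi2 {C : numClosedFieldType} (n : nat) (A B : 'M[C]_(2 ^ n)) (sigma : pstring n) : C :=
  \tr (A *m pauli sigma) * \tr (B *m pauli sigma).

Definition tXi2 {C : numClosedFieldType} (n : nat) (A B : 'M[C]_(2 ^ n)) (sigma : pstring n) : C :=
  \tr (A *m pauli sigma *m B *m pauli sigma).

(** squared l2 norm and inner product of functions on Pbar_n (vectors in R^{d^2}) *)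
Definition l2sq {C : numClosedFieldType} (n : nat) (f : pstring n -> C) : C :=
  \sum_(sigma : pstring n) `|f sigma| ^+ 2.

Definition vdot {C : numClosedFieldType} (n : nat) (f g : pstring n -> C) : C :=
  \sum_(sigma : pstring n) f sigma * g sigma.

(** V_triangle(O, rho) *)
Definition Vtri {C : numClosedFieldType} (n : nat) (O rho : 'M[C]_(2 ^ n)) : C :=
  ((2 ^ n).+1)%:R / ((2 ^ n)%:R * ((2 ^ n).+2)%:R)
  * (l2sq (Xi2 rho O) + vdot (tXi2 rho O) (Xi2 rho O)).

(** squared Hilbert-Schmidt norm *)
Definition hs2 {C : numClosedFieldType} (m : nat) (O : 'M[C]_m) : C := \sum_(i < m) \sum_(j < m) `|O i j| ^+ 2.

(* Main.v *)
Require Import Defs.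
From HB Require Import structures.
From mathcomp Require Import all_boot all_order all_algebra.
From mathcomp Require Import ring.
Set Implicit Arguments. Unset Strict Implicit. Unset Printing Implicit Defensive.
Import Order.TTheory GRing.Theory Num.Theory.
Local Open Scope ring_scope.

(** Since [|b><b|] is a combination of the [d] Pauli strings in [{I,Z}^n], the
   expression [sum_b <b|U rho U^+|b> <b|U O U^+|b>] is [1/d] times the sum of
   [Xi(U^+ Z U)] over these strings.  The Clifford average of [Xi(U^+ P U) Xi(U^+ Q U)]
   is constant over [P = Q <> I], and over the commuting pairs [P <> Q] of
   non-identity strings, because the unitaries [(1 +- i R)/sqrt 2] with [R] a Pauli
   string are Clifford and act on strings as symplectic transvections, which are
   transitive on both sets.  Counting the two orbits gives the formula for [V_*].
   The inequalities hold because [tXi] is the unitary symplectic Fourier transform of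
   [Xi], so that [|tXi| = |Xi|], and because [|tr (rho P)| <= 1]. *)

(** * Basis indices as bit strings, and factorisation over qubits *)

Lemma bit_inj (n i j : nat) : (i < 2 ^ n)%N -> (j < 2 ^ n)%N ->
  (forall k, (k < n)%N -> bit k i = bit k j) -> i = j.
Proof.
elim: n i j => [|n IHn] i j; first by rewrite expn0 !ltnS !leqn0 => /eqP-> /eqP->.
rewrite expnS => lti ltj eq_bit.
rewrite -(odd_double_half i) -(odd_double_half j).
have := eq_bit 0%N isT; rewrite /bit expn0 !divn1 => ->; congr (_ + _.*2)%N.
apply: IHn => [||k ltk]; rewrite -?divn2 ?ltn_divLR // 1?mulnC //.
by have := eq_bit k.+1 ltk; rewrite /bit expnS !divnMA.
Qed.

Lemma bits_bij (n : nat) :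
  bijective (fun i : 'I_(2 ^ n) => [ffun k : 'I_n => bit k i]).
Proof.
apply: inj_card_bij => [i j /ffunP eq_bit|]; last first.
  by rewrite card_ffun card_bool !card_ord.
apply/val_inj/(bit_inj (ltn_ord i) (ltn_ord j)) => k ltk.
by have := eq_bit (Ordinal ltk); rewrite !ffunE.
Qed.

(** An index below [2 ^ n] is the same as a choice of [n] bits, so distributivity applies. This
    reduces the string identities below to checks on one qubit. *)
Lemma sum_prod_bit (R : comPzSemiRingType) (n : nat) (F : 'I_n -> bool -> R) :
  \sum_(i < 2 ^ n) \prod_(k < n) F k (bit k i) = \prod_(k < n) \sum_b F k b.
Proof.
rewrite bigA_distr_bigA /= (reindex _ (onW_bij _ (bits_bij n))) /=.
by apply: eq_bigr => i _; apply: eq_bigr => k _; rewrite ffunE.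
Qed.

Lemma prod_eq_ffun (R : comPzSemiRingType) (n : nat) (T : eqType) (f g : {ffun 'I_n -> T}) :
  \prod_(k < n) ((f k == g k)%:R : R) = (f == g)%:R.
Proof.
have [->|neq_fg] := eqVneq f g; first by rewrite big1 // => k _; rewrite eqxx.
have [k neq_k|eq_fg] := pickP (fun k : 'I_n => f k != g k).
  by rewrite (bigD1 k) //= (negPf neq_k) mul0r.
by case/eqP: neq_fg; apply/ffunP => k; apply/eqP; move/negbT: (eq_fg k); rewrite negbK.
Qed.

Lemma prod_eq_bit (R : comPzSemiRingType) (n : nat) (i j : 'I_(2 ^ n)) :
  \prod_(k < n) ((bit k i == bit k j)%:R : R) = (i == j)%:R.
Proof.
rewrite -(inj_eq (bij_inj (bits_bij n))) -prod_eq_ffun.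
by apply: eq_bigr => k _; rewrite !ffunE.
Qed.

(** * Multiplication of Pauli labels modulo phase (a power of the Klein four-group) *)

Definition pmul1 (s t : 'I_4) : 'I_4 :=
  match val s, val t with
  | 0, _ => t
  | _, 0 => s
  | 1, 2 | 2, 1 => @Ordinal 4 3 isT
  | 1, 3 | 3, 1 => @Ordinal 4 2 isT
  | 2, 3 | 3, 2 => @Ordinal 4 1 isT
  | _, _ => ord0
  end.

(* The exponent [k] in [s t = i^k (pmul1 s t)]; for example [X Y = i Z]. *)
Definition pphase1 (s t : 'I_4) : nat :=
  match val s, val t with
  | 1, 2 | 2, 3 | 3, 1 => 1
  | 2, 1 | 3, 2 | 1, 3 => 3
  | _, _ => 0
  end.

Ltac case_I4 s := case: s => [[|[|[|[|?]]]] ?] //.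

Definition pmul {n : nat} (sigma tau : pstring n) : pstring n :=
  [ffun k => pmul1 (sigma k) (tau k)].

Definition pid {n : nat} : pstring n := [ffun=> ord0].

Lemma pmulK n (sigma tau : pstring n) : pmul sigma (pmul sigma tau) = tau.
Proof.
apply/ffunP => k; rewrite !ffunE; move: (sigma k) (tau k) => s t.
by case_I4 s; case_I4 t; apply: val_inj.
Qed.

Lemma pmulC n (sigma tau : pstring n) : pmul sigma tau = pmul tau sigma.
Proof.
apply/ffunP => k; rewrite !ffunE; move: (sigma k) (tau k) => s t.
by case_I4 s; case_I4 t; apply: val_inj.
Qed.

Lemma pmulpp n (sigma : pstring n) : pmul sigma sigma = pid.
Proof.
apply/ffunP => k; rewrite !ffunE; move: (sigma k) => s.
by case_I4 s; apply: val_inj.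
Qed.

Lemma pmul1p n (sigma : pstring n) : pmul pid sigma = sigma.
Proof. by apply/ffunP => k; rewrite !ffunE. Qed.

Lemma pmulp1 n (sigma : pstring n) : pmul sigma pid = sigma.
Proof. by rewrite pmulC pmul1p. Qed.

Lemma pmul_eq n (sigma tau mu : pstring n) : (pmul sigma tau == mu) = (tau == pmul sigma mu).
Proof. by apply/eqP/eqP => [<-|->]; rewrite pmulK. Qed.

(** * Single-qubit Pauli identities *)

Section Pauli.
Variable C : numClosedFieldType.

(** The commutation sign of two single-qubit Paulis: they commute exactly when they are equal or one
    of them is [I]. *)
Definition chi1 (s t : 'I_4) : C := if [|| val s == 0, val t == 0 | s == t]%N then 1 else -1.

Lemma pauli1M (s t : 'I_4) (a b : bool) :
  \sum_c pauli1 s a c * pauli1 t c b = 'i ^+ pphase1 s t * pauli1 (pmul1 s t) a b :> C.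
Proof.
have i3 : 'i ^+ 3 = - 'i :> C by rewrite exprS sqrCi mulrN1.
have ii : 'i * 'i = -1 :> C by rewrite -expr2 sqrCi.
rewrite big_bool; case_I4 s; case_I4 t; case: a; case: b;
  rewrite /pauli1 /pphase1 /pmul1 /= ?expr0 ?expr1 ?i3;
  by rewrite ?(mulr0, mul0r, mulr1, mul1r, mulrN, mulNr, addr0, add0r, ii, opprK).
Qed.

Lemma pauli1_conj (s : 'I_4) (a b : bool) : (pauli1 s b a)^* = pauli1 s a b :> C.
Proof.
case_I4 s; case: a; case: b; rewrite /pauli1 /= ?rmorphN /= ?conjCi ?opprK ?conjC1 ?conjC0 //.
Qed.

(** Entrywise form of the fact that the sum of [P (x) P] over the four Paulis is twice the swap
    operator. *)
Lemma pauli1_kernel (a b c e : bool) :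
  \sum_(s < 4) pauli1 s a b * pauli1 s c e = 2 * (a == e)%:R * (b == c)%:R :> C.
Proof.
have ii : 'i * 'i = -1 :> C by rewrite -expr2 sqrCi.
rewrite !big_ord_recl big_ord0 /pauli1 /=.
by case: a; case: b; case: c; case: e => /=;
  rewrite ?(mulr0, mul0r, mulr1, mul1r, mulrN, mulNr, addr0, add0r, ii, opprK, subrr) //.
Qed.

Definition zlabel : pred 'I_4 := [pred s | (val s == 0) || (val s == 3)]%N.

(** Entrywise form of [I (x) I + Z (x) Z] being twice the projector onto equal bits. *)
Lemma zlabel_kernel (a b c e : bool) :
  \sum_(s | zlabel s) pauli1 s a b * pauli1 s c e
  = 2 * (a == b)%:R * (b == c)%:R * (c == e)%:R :> C.
Proof.
rewrite big_mkcond !big_ord_recl big_ord0 /pauli1 /=.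
by case: a; case: b; case: c; case: e => /=;
  rewrite ?(mulr0, mul0r, mulr1, mul1r, mulrN, mulNr, addr0, add0r, opprK, subrr) //.
Qed.

Lemma chi1_comm (s t : 'I_4) :
  'i ^+ pphase1 s t = chi1 s t * 'i ^+ pphase1 t s :> C.
Proof.
have i3 : 'i ^+ 3 = - 'i :> C by rewrite exprS sqrCi mulrN1.
by case_I4 s; case_I4 t; rewrite /chi1 /pphase1 /= ?i3 ?mul1r ?mulN1r ?opprK.
Qed.

Lemma chi1M (r s t : 'I_4) : chi1 r (pmul1 s t) = chi1 r s * chi1 r t.
Proof.
by case_I4 r; case_I4 s; case_I4 t; rewrite /chi1 /pmul1 /= ?mul1r ?mulN1r ?opprK.
Qed.

Lemma sum_chi1 (s : 'I_4) : \sum_r chi1 r s = 4 * (s == ord0)%:R.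
Proof.
rewrite !big_ord_recl big_ord0; case_I4 s; rewrite /chi1 /=; ring.
Qed.

End Pauli.

(** * Adjoints, unitaries and real traces *)

Section Adjoint.
Variables (C : numClosedFieldType) (m : nat).
Implicit Types A B U : 'M[C]_m.

Lemma adjmxM A B : adjmx (A *m B) = adjmx B *m adjmx A.
Proof.
apply/matrixP => i j; rewrite !mxE rmorph_sum; apply: eq_bigr => k _.
by rewrite !mxE rmorphM mulrC.
Qed.

Lemma adjmxZ a A : adjmx (a *: A) = a^* *: adjmx A.
Proof. by apply/matrixP => i j; rewrite !mxE rmorphM. Qed.

Lemma adjmxD A B : adjmx (A + B) = adjmx A + adjmx B.
Proof. by apply/matrixP => i j; rewrite !mxE rmorphD. Qed.

Lemma adjmx1 : adjmx 1%:M = 1%:M :> 'M[C]_m.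
Proof. by apply/matrixP => i j; rewrite !mxE rmorph_nat eq_sym. Qed.

Lemma mxtrace_adj A : \tr (adjmx A) = (\tr A)^*.
Proof. by rewrite /mxtrace rmorph_sum; apply: eq_bigr => i _; rewrite mxE. Qed.

Lemma unitaryVl U : unitary U -> adjmx U *m U = 1%:M.
Proof. exact: mulmx1C. Qed.

Lemma unitaryM U V : unitary U -> unitary V -> unitary (U *m V).
Proof.
by rewrite /unitary adjmxM mulmxA -(mulmxA U) => uU ->; rewrite mulmx1.
Qed.

Lemma herm_mxtrace_real A B : herm_op A -> herm_op B -> (\tr (A *m B))^* = \tr (A *m B).
Proof. by move=> hA hB; rewrite -mxtrace_adj adjmxM hA hB mxtrace_mulC. Qed.

End Adjoint.

(** * Pauli strings: products, completeness, commutation characters *)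

Section PauliStrings.
Variables (C : numClosedFieldType) (n : nat).
Local Notation d := ((2 ^ n)%:R : C).
Implicit Types (sigma tau mu : pstring n) (A B X : 'M[C]_(2 ^ n)).

Definition pphase sigma tau : nat := \sum_(k < n) pphase1 (sigma k) (tau k).

Definition chi sigma tau : C := \prod_(k < n) chi1 C (sigma k) (tau k).

Lemma dim_gt0 : 0 < d. Proof. by rewrite ltr0n expn_gt0. Qed.

Lemma dim_neq0 : d != 0. Proof. by rewrite lt0r_neq0 // dim_gt0. Qed.

Lemma pauliM sigma tau :
  pauli sigma *m pauli tau = 'i ^+ pphase sigma tau *: pauli (pmul sigma tau) :> 'M[C]_(2 ^ n).
Proof.
apply/matrixP => i j; rewrite !mxE expr_sum.
under [LHS]eq_bigr => l _ do rewrite !mxE -big_split /=.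
pose F (k : 'I_n) b : C := pauli1 (sigma k) (bit k i) b * pauli1 (tau k) b (bit k j).
rewrite (sum_prod_bit F) -big_split; apply: eq_bigr => k _ /=.
by rewrite pauli1M ffunE.
Qed.

Lemma adjmx_pauli sigma : adjmx (pauli sigma) = pauli sigma :> 'M[C]_(2 ^ n).
Proof.
apply/matrixP => i j; rewrite !mxE rmorph_prod; apply: eq_bigr => k _.
exact: pauli1_conj.
Qed.

Lemma pauli_pid : pauli pid = 1%:M :> 'M[C]_(2 ^ n).
Proof.
apply/matrixP => i j; rewrite !mxE -(prod_eq_bit C); apply: eq_bigr => k _.
by rewrite ffunE /pauli1 /=; case: eqP.
Qed.

Lemma pauli_sqr sigma : pauli sigma *m pauli sigma = 1%:M :> 'M[C]_(2 ^ n).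
Proof.
rewrite pauliM pmulpp pauli_pid /pphase big1 ?scale1r // => k _.
by move: (sigma k) => s; case_I4 s.
Qed.

Lemma pauli_comm sigma tau :
  pauli sigma *m pauli tau = chi sigma tau *: (pauli tau *m pauli sigma) :> 'M[C]_(2 ^ n).
Proof.
rewrite !pauliM scalerA pmulC /pphase !expr_sum -big_split; congr (_ *: _).
by apply: eq_bigr => k _; rewrite chi1_comm.
Qed.

Lemma mxtrace_pauli sigma : \tr (pauli sigma) = d * (sigma == pid)%:R :> C.
Proof.
rewrite /mxtrace; under eq_bigr => i _ do rewrite mxE.
pose F (k : 'I_n) b : C := pauli1 (sigma k) b b.
rewrite (sum_prod_bit F) natrX -[X in X ^+ n]/(2%:R).
rewrite -[X in _ ^+ X](card_ord n) -prodr_const -(prod_eq_ffun C) -big_split.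
apply: eq_bigr => k _ /=; rewrite ffunE /F big_bool; move: (sigma k) => s.
case_I4 s; rewrite /pauli1 /=; ring.
Qed.

Lemma pauli_kernel (i j k l : 'I_(2 ^ n)) :
  \sum_sigma pauli sigma i j * pauli sigma k l = d * (i == l)%:R * (j == k)%:R :> C.
Proof.
under eq_bigr => sigma _ do rewrite !mxE -big_split /=.
pose F (q : 'I_n) s : C := pauli1 s (bit q i) (bit q j) * pauli1 s (bit q k) (bit q l).
rewrite -(bigA_distr_bigA F) natrX -[X in _ ^+ X](card_ord n) -prodr_const.
rewrite -!(prod_eq_bit C) -!big_split; apply: eq_bigr => q _.
exact: pauli1_kernel.
Qed.

(** These are the diagonal strings, those in [{I,Z}^n]. *)
Definition zstring sigma : bool := sigma \in ffun_on zlabel.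

Lemma zstring_kernel (i j k l : 'I_(2 ^ n)) :
  \sum_(sigma | zstring sigma) pauli sigma i j * pauli sigma k l
  = d * (i == j)%:R * (j == k)%:R * (k == l)%:R :> C.
Proof.
under eq_bigr => sigma _ do rewrite !mxE -big_split /=.
pose F (q : 'I_n) s : C := pauli1 s (bit q i) (bit q j) * pauli1 s (bit q k) (bit q l).
rewrite -(bigA_distr_big _ F) natrX -[X in _ ^+ X](card_ord n) -prodr_const.
rewrite -!(prod_eq_bit C) -!big_split; apply: eq_bigr => q _.
exact: zlabel_kernel.
Qed.

Lemma card_zstring : #|zstring| = (2 ^ n)%N.
Proof.
rewrite card_ffun_on card_ord; congr (_ ^ _)%N.
by rewrite -sum1_card big_mkcond !big_ord_recl big_ord0.
Qed.

Lemma zstring_pid : zstring pid.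
Proof. by apply/ffun_onP => k; rewrite ffunE. Qed.

(** Completeness of the Pauli basis; in the double sum for the trace, [pauli_kernel] leaves a single
    pair of indices. *)
Lemma sum_pauli_mxtrace A : \sum_sigma \tr (A *m pauli sigma) *: pauli sigma = d *: A.
Proof.
apply/matrixP => k l; rewrite summxE !mxE.
under eq_bigr => sigma _ do rewrite mxE /mxtrace mulr_suml.
rewrite exchange_big /= (bigD1 k) //= [X in _ + X]big1 ?addr0; last first.
  move=> i neq_ik; under eq_bigr => sigma _ do rewrite mxE mulr_suml.
  rewrite exchange_big /= big1 // => j _.
  under eq_bigr => sigma _ do rewrite -mulrA.
  by rewrite -mulr_sumr pauli_kernel (negPf neq_ik) !mulr0.
under eq_bigr => sigma _ do rewrite mxE mulr_suml.
rewrite exchange_big /= (bigD1 l) //= [X in _ + X]big1 ?addr0; last first.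
  move=> j neq_jl; under eq_bigr => sigma _ do rewrite -mulrA.
  by rewrite -mulr_sumr pauli_kernel (negPf neq_jl) mulr0 mul0r mulr0.
under eq_bigr => sigma _ do rewrite -mulrA.
by rewrite -mulr_sumr pauli_kernel !eqxx !mulr1 mulrC.
Qed.

Lemma sum_mxtrace_pauli2 A B :
  \sum_sigma \tr (A *m pauli sigma) * \tr (B *m pauli sigma) = d * \tr (A *m B).
Proof.
rewrite mxtrace_mulC -mxtraceZ scalemxAr -sum_pauli_mxtrace mulmx_sumr linear_sum.
by apply: eq_bigr => sigma _; rewrite -scalemxAr /= mxtraceZ.
Qed.

(** The strings in [{I,Z}^n] form an orthogonal basis of the diagonal matrices, so expanding along
    them dephases [A]. This is where measurement in the computational basis turns into Pauli
    strings. *)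
Lemma sum_zstring_mxtrace A :
  \sum_(sigma | zstring sigma) \tr (A *m pauli sigma) *: pauli sigma
  = d *: \sum_b A b b *: delta_mx b b.
Proof.
apply/matrixP => k l; rewrite summxE mxE summxE.
under eq_bigr => sigma _ do rewrite mxE /mxtrace mulr_suml.
rewrite exchange_big mulr_sumr; apply: eq_bigr => i _ /=.
under eq_bigr => sigma _ do rewrite mxE mulr_suml.
rewrite exchange_big (bigD1 i) //= [X in _ + X]big1 ?addr0 => [|j neq_ji].
  under eq_bigr => sigma _ do rewrite -mulrA.
  rewrite -mulr_sumr zstring_kernel !mxE eqxx.
  rewrite (eq_sym i k) (eq_sym l i).
  have [->|_] := eqVneq k i => /=; last by rewrite !(mulr0, mul0r).
  by have [->|_] := eqVneq i l; rewrite !(mulr1, mulr0) // mulrC.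
under eq_bigr => sigma _ do rewrite -mulrA.
by rewrite -mulr_sumr zstring_kernel (negPf neq_ji) mulr0 !mul0r mulr0.
Qed.

Lemma sum_zstring_mxtrace2 A B :
  \sum_(sigma | zstring sigma) \tr (A *m pauli sigma) * \tr (B *m pauli sigma)
  = d * \sum_b A b b * B b b.
Proof.
have trB b : \tr (B *m delta_mx b b) = B b b.
  rewrite /mxtrace (bigD1 b) //= big1 ?addr0 => [|i neq_ib].
    rewrite mxE (bigD1 b) //= big1 ?addr0 ?mxE ?eqxx ?mulr1 // => j neq_jb.
    by rewrite mxE (negPf neq_jb) mulr0.
  by rewrite mxE big1 // => j _; rewrite mxE (negPf neq_ib) andbF mulr0.
transitivity (\tr (B *m \sum_(sigma | zstring sigma) \tr (A *m pauli sigma) *: pauli sigma)).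
  rewrite mulmx_sumr linear_sum; apply: eq_bigr => sigma _ /=.
  by rewrite -scalemxAr mxtraceZ.
rewrite sum_zstring_mxtrace -scalemxAr mxtraceZ mulmx_sumr linear_sum; congr (_ * _).
by apply: eq_bigr => b _; rewrite -scalemxAr /= mxtraceZ trB.
Qed.

(** If the labels differed, the square of [pauli sigma] would be a multiple of a traceless string,
    although it is the identity, of trace [d]. *)
Lemma pauli_inj a sigma tau : pauli sigma = a *: pauli tau :> 'M[C]_(2 ^ n) -> sigma = tau.
Proof.
move=> eq_st; have := mxtrace_pauli (pmul tau sigma).
have [<-//|neq] := eqVneq tau sigma.
move/eqP; rewrite pmul_eq pmulp1 [sigma == _]eq_sym (negPf neq) mulr0 => /eqP tr0.
have /(congr1 mxtrace) := pauli_sqr sigma.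
rewrite {1}eq_st -scalemxAl pauliM !mxtraceZ tr0 !mulr0 mxtrace1 => /eqP.
by rewrite eq_sym (negPf dim_neq0).
Qed.

Lemma chiC sigma tau : chi sigma tau = chi tau sigma.
Proof.
apply: eq_bigr => k _; move: (sigma k) (tau k) => s t.
by case_I4 s; case_I4 t.
Qed.

Lemma chiM sigma tau mu : chi sigma (pmul tau mu) = chi sigma tau * chi sigma mu.
Proof. by rewrite /chi -big_split; apply: eq_bigr => k _; rewrite ffunE chi1M. Qed.

Lemma chipp sigma : chi sigma sigma = 1.
Proof. by rewrite /chi big1 // => k _; rewrite /chi1 eqxx !orbT. Qed.

Lemma chip1 sigma : chi sigma pid = 1.
Proof. by rewrite /chi big1 // => k _; rewrite ffunE /chi1 orbT. Qed.

Lemma chi1p sigma : chi pid sigma = 1.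
Proof. by rewrite chiC chip1. Qed.

Lemma chi_sqr sigma tau : chi sigma tau * chi sigma tau = 1.
Proof. by rewrite -chiM pmulpp chip1. Qed.

Lemma chi_neq1 sigma tau : chi sigma tau != 1 -> chi sigma tau = -1.
Proof.
move=> neq1; have /eqP := chi_sqr sigma tau.
by rewrite -expr2 sqrf_eq1 (negPf neq1) => /eqP.
Qed.

(** Orthogonality of characters: each qubit contributes a factor 4 or 0. *)
Lemma sum_chi tau : \sum_sigma chi sigma tau = d ^+ 2 * (tau == pid)%:R.
Proof.
rewrite /chi -(bigA_distr_bigA (fun k s => chi1 C s (tau k))).
rewrite -natrX -expnM mulnC expnM natrX -[X in _ ^+ X](card_ord n) -prodr_const.
rewrite -(prod_eq_ffun C) -big_split; apply: eq_bigr => k _ /=.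
by rewrite ffunE sum_chi1.
Qed.

Lemma zstring_chi sigma tau : zstring sigma -> zstring tau -> chi sigma tau = 1.
Proof.
move=> /ffun_onP zs /ffun_onP zt; rewrite /chi big1 // => k _.
move: (sigma k) (tau k) (zs k) (zt k) => s t; by case_I4 s; case_I4 t.
Qed.

End PauliStrings.

(** * Symplectic transvections: transitivity and Clifford realisation *)

Section Transvections.
Variables (C : numClosedFieldType) (n : nat).
Local Notation d := ((2 ^ n)%:R : C).
Local Notation chi := (chi C).
Implicit Types (rho sigma tau mu nu : pstring n).

(* The symplectic transvection along [mu]. *)
Definition tv mu sigma : pstring n := if chi mu sigma == 1 then sigma else pmul mu sigma.

Definition cpair sigma tau : bool :=
  [&& sigma != pid, tau != pid, sigma != tau & chi sigma tau == 1].

Lemma tv_id mu sigma : chi mu sigma = 1 -> tv mu sigma = sigma.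
Proof. by rewrite /tv => ->; rewrite eqxx. Qed.

Lemma tv_pid mu : tv mu pid = pid.
Proof. by rewrite tv_id ?chip1. Qed.

Lemma tvK mu : involutive (tv mu).
Proof.
move=> sigma; rewrite /tv; have [->|neq1] := eqVneq (chi mu sigma) 1; first by rewrite eqxx.
by rewrite chiM chipp mul1r (negPf neq1) pmulK.
Qed.

Lemma tv_swap sigma tau : chi sigma tau != 1 -> tv (pmul sigma tau) sigma = tau.
Proof.
move=> neq1; rewrite /tv chiC chiM chipp mul1r (negPf neq1).
by rewrite pmulC pmulK.
Qed.

Lemma chi_tv mu sigma tau : chi (tv mu sigma) (tv mu tau) = chi sigma tau.
Proof.
rewrite /tv; have [es|ns] := eqVneq (chi mu sigma) 1;
  have [et|nt] := eqVneq (chi mu tau) 1 => //.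
- by rewrite chiM chiC es mul1r.
- by rewrite chiC chiM chiC et mul1r chiC.
- rewrite chiM ![chi (pmul _ _) _]chiC !chiM chipp (chiC C tau mu) (chiC C tau sigma).
  by rewrite (chi_neq1 ns) (chi_neq1 nt) mul1r mulrA mulrNN !mul1r.
Qed.

Lemma cpair_tv mu sigma tau : cpair (tv mu sigma) (tv mu tau) = cpair sigma tau.
Proof.
rewrite /cpair chi_tv (inj_eq (inv_inj (tvK mu))).
by rewrite -{1 2}(tv_pid mu) !(inj_eq (inv_inj (tvK mu))).
Qed.

(* The sum over [mu] of [(1 + chi mu rho) (1 - chi mu sigma) (1 - chi mu tau)]
   is positive, by orthogonality of the characters [chi ^~ sigma]. *)
Lemma anticommuting_exists rho sigma tau :
  sigma != pid -> tau != pid -> rho != sigma -> rho != tau ->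
  exists mu, [/\ chi mu rho = 1, chi mu sigma != 1 & chi mu tau != 1].
Proof.
move=> s1 t1 rs rt.
have [mu /and3P[/eqP ? ? ?]|none] :=
  pickP (fun mu => [&& chi mu rho == 1, chi mu sigma != 1 & chi mu tau != 1]).
  by exists mu.
have sum0 : \sum_mu (1 + chi mu rho) * (1 - chi mu sigma) * (1 - chi mu tau) = 0.
  apply: big1 => mu _; have := none mu.
  have [->|ns] := eqVneq (chi mu sigma) 1; first by rewrite subrr mulr0 mul0r.
  have [->|nt] := eqVneq (chi mu tau) 1; first by rewrite subrr mulr0.
  by have [//|/chi_neq1 ->] := eqVneq (chi mu rho) 1; rewrite subrr !mul0r.
(* Of the eight characters in the expansion, those of [sigma], [tau], [rho sigma] and [rho tau] are
   nontrivial and sum to zero. The trivial one gives the 1 and the other three give nonnegative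
   counts. *)
have : \sum_mu (1 + chi mu rho) * (1 - chi mu sigma) * (1 - chi mu tau) =
  d ^+ 2 * (1 + (rho == pid) + (pmul sigma tau == pid)
     + (pmul rho (pmul sigma tau) == pid))%:R.
  transitivity (\sum_mu (chi mu pid + chi mu rho - chi mu sigma - chi mu tau
     + chi mu (pmul sigma tau) - chi mu (pmul rho sigma) - chi mu (pmul rho tau)
     + chi mu (pmul rho (pmul sigma tau)))).
    by apply: eq_bigr => mu _; rewrite !chiM chip1; ring.
  rewrite !big_split /= !sumrN !sum_chi eqxx (negPf s1) (negPf t1).
  rewrite !(pmul_eq rho) !pmulp1 ![_ == rho]eq_sym (negPf rs) (negPf rt) !natrD /=; ring.
rewrite sum0 => /esym/eqP; rewrite mulf_eq0 expf_eq0 (negPf (dim_neq0 C n)) andbF.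
by rewrite pnatr_eq0.
Qed.

(** Anticommuting strings are exchanged by the transvection along their product; commuting ones are
    joined through a third string that anticommutes with both. Fixing [rho] throughout gives
    transitivity inside its commutant. *)
Lemma tv_path rho sigma tau :
  sigma != pid -> tau != pid -> rho != sigma -> rho != tau ->
  chi rho sigma = 1 -> chi rho tau = 1 ->
  exists mu nu, [/\ tv mu rho = rho, tv nu rho = rho & tv nu (tv mu sigma) = tau].
Proof.
move=> s1 t1 rs rt crs crt.
have [st|st] := eqVneq (chi sigma tau) 1; last first.
  (* One transvection is enough here; the one along [pid] is trivial. *)
  exists (pmul sigma tau), pid; rewrite tv_swap // !tv_id ?chi1p //.
  by rewrite chiC chiM crs crt mul1r.
have [mu [mr ms mt]] := anticommuting_exists s1 t1 rs rt.
(* The route is [sigma], then [mu], then [tau]. Both products commute with [rho] because all three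
   strings do. *)
exists (pmul sigma mu), (pmul mu tau); rewrite tv_swap 1?chiC // tv_swap //.
by rewrite !tv_id //; rewrite chiC chiM (chiC C rho mu) mr ?crs ?crt mul1r.
Qed.

Lemma tv_invariant_diag (T : Type) (K : pstring n -> pstring n -> T) :
  (forall mu sigma tau, K (tv mu sigma) (tv mu tau) = K sigma tau) ->
  forall sigma tau, sigma != pid -> tau != pid -> K sigma sigma = K tau tau.
Proof.
move=> Kinv sigma tau s1 t1.
have [||||mu [nu [_ _ <-]]] := @tv_path pid sigma tau s1 t1; rewrite ?chi1p // 1?eq_sym //.
by rewrite !Kinv.
Qed.

(** A Witt-type argument in two stages: first the first components are matched, with [rho := pid] in
    [tv_path]; then the second components are matched while the common first component stays
    fixed. *)
Lemma tv_invariant_cpair (T : Type) (K : pstring n -> pstring n -> T) :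
  (forall mu sigma tau, K (tv mu sigma) (tv mu tau) = K sigma tau) ->
  forall sigma sigma' tau tau', cpair sigma sigma' -> cpair tau tau' ->
  K sigma sigma' = K tau tau'.
Proof.
move=> Kinv sigma sigma' tau tau' css ctt.
have [s1 _ _ _] := and4P css; have [t1 t1' tt /eqP ctt1] := and4P ctt.
have [||||mu [nu [_ _ st]]] := @tv_path pid sigma tau s1 t1; rewrite ?chi1p // 1?eq_sym //.
rewrite -(Kinv mu) -(Kinv nu) st; move: css; rewrite -(cpair_tv mu) -(cpair_tv nu) st.
move: (tv nu (tv mu sigma')) => tau'' /and4P[_ s1'' ts /eqP cts].
have [mu' [nu' [mt nt <-]]] := tv_path s1'' t1' ts tt cts ctt1.
by rewrite -(Kinv mu') -(Kinv nu') mt nt.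
Qed.

(* For [c = +-i] this is [exp (+- i pi P / 4)]; conjugation by it realises [tv mu]
   up to signs. *)
Definition tvmx (c : C) mu : 'M[C]_(2 ^ n) :=
  (sqrtC 2)^-1 *: (1%:M + c *: pauli mu).

Lemma sqr_eqN1 (c : C) : c ^+ 2 = -1 -> c = 'i \/ c = - 'i.
Proof. by move/eqP; rewrite -sqrCi eqf_sqr => /orP[] /eqP ->; [left|right]. Qed.

Lemma adj_tvmx c mu : c ^+ 2 = -1 -> adjmx (tvmx c mu) = tvmx (- c) mu.
Proof.
move=> c2; rewrite adjmxZ adjmxD adjmx1 adjmxZ adjmx_pauli.
have -> : c^* = - c by case: (sqr_eqN1 c2) => ->; rewrite ?rmorphN /= conjCi.
by rewrite geC0_conj // invr_ge0 sqrtC_ge0 ler0n.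
Qed.

(** Up to the factor 1/2 the product is [(1 + c P) Q (1 - c P)]. If [P] and [Q] commute, the terms
    in [P Q] cancel; if they anticommute, the terms in [Q] cancel and those in [P Q] double. *)
Lemma tvmx_conj c mu sigma : c ^+ 2 = -1 ->
  tvmx c mu *m pauli sigma *m tvmx (- c) mu =
  if chi mu sigma == 1 then pauli sigma else c *: (pauli mu *m pauli sigma).
Proof.
move=> c2; rewrite /tvmx -!scalemxAl -scalemxAr scalerA -invfM -expr2 sqrtCK.
rewrite mulmxDl mul1mx mulmxDr mulmx1 mulmxDl -scalemxAl -scalemxAr.
rewrite -!scalemxAr -!scalemxAl scalerA.
have PQP : pauli mu *m pauli sigma *m pauli mu = chi mu sigma *: pauli sigma :> 'M[C]_(2 ^ n).
  by rewrite pauli_comm -scalemxAl -mulmxA pauli_sqr mulmx1.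
rewrite PQP (pauli_comm C sigma mu) (chiC C sigma mu) !scalerA.
set P := pauli mu *m pauli sigma; rewrite addrACA.
have [->|/chi_neq1 ->] := eqVneq (chi mu sigma) 1.
  rewrite !mulr1 mulNr -expr2 c2 opprK scale1r scaleNr subrKA.
  by rewrite -mulr2n -scaler_nat scalerA mulVf ?pnatr_eq0 // scale1r.
rewrite !mulrN1 mulNr !opprK -expr2 c2 scaleN1r [pauli _ + _]addrC addrACA subrr addr0.
by rewrite -mulr2n -scaler_nat !scalerA mulrA mulVf ?pnatr_eq0 // mul1r.
Qed.

Lemma unitary_tvmx c mu : c ^+ 2 = -1 -> unitary (tvmx c mu).
Proof.
move=> c2; rewrite /unitary adj_tvmx //.
have := tvmx_conj mu pid c2; rewrite chip1 eqxx pauli_pid => <-.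
by rewrite mulmx1.
Qed.

Lemma clifford_tvmx c mu : c ^+ 2 = -1 -> clifford (tvmx c mu).
Proof.
move=> c2; split; first exact: unitary_tvmx.
have conj_in c' M : c' ^+ 2 = -1 -> in_pauli_group M ->
    in_pauli_group (tvmx c' mu *m M *m tvmx (- c') mu).
  move=> c2' [k [sigma ->]].
  (* Membership in the Pauli group asks for a phase that is a power of ['i]. *)
  have [m c'E] : exists m, c' = 'i ^+ m.
    case: (sqr_eqN1 c2') => ->; first by exists 1%N.
    by exists 3%N; rewrite exprS sqrCi mulrN1.
  rewrite -(scalemxAr _ (tvmx c' mu)) -(scalemxAl _ _ (tvmx (- c') mu)) tvmx_conj //.
  case: ifP => _; first by exists k, sigma.
  exists (k + (m + pphase mu sigma))%N, (pmul mu sigma).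
  by rewrite pauliM !scalerA c'E !exprD mulrA.
have c2N : (- c) ^+ 2 = -1 by rewrite sqrrN.
move=> M; rewrite adj_tvmx //; split=> [|inM]; first exact: conj_in.
(* Conjugating with the opposite sign of [c] undoes the conjugation, which gives the converse. *)
have := conj_in _ _ c2N inM.
have uN := unitaryVl (unitary_tvmx mu c2); rewrite adj_tvmx // in uN.
by rewrite opprK !mulmxA uN mul1mx -mulmxA uN mulmx1.
Qed.

End Transvections.

(** * The action of Clifford unitaries on Pauli labels *)

Section CliffordAction.
Variables (C : numClosedFieldType) (n : nat).
Local Notation chi := (chi C).
Implicit Types (sigma tau mu : pstring n) (U V : 'M[C]_(2 ^ n)).

Lemma clifford_unitary U : clifford U -> unitary U.
Proof. by case. Qed.

Lemma cliffordM U V : clifford U -> clifford V -> clifford (U *m V).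
Proof.
move=> [uU cU] [uV cV]; split; first exact: unitaryM.
move=> M; rewrite adjmxM !mulmxA -(mulmxA U) -(mulmxA U).
exact: iff_trans (cV M) (cU _).
Qed.

Lemma unitary_conjM U A B : unitary U ->
  (adjmx U *m A *m U) *m (adjmx U *m B *m U) = adjmx U *m (A *m B) *m U.
Proof. by move=> uU; rewrite !mulmxA -(mulmxA _ U) uU mulmx1. Qed.

Lemma scale_pauli_inj (a b : C) sigma :
  a *: pauli sigma = b *: pauli sigma :> 'M[C]_(2 ^ n) -> a = b.
Proof.
move/(congr1 (mulmx (pauli sigma))); rewrite -!scalemxAr pauli_sqr.
by move/(congr1 mxtrace); rewrite !mxtraceZ mxtrace1; apply/mulIf/dim_neq0.
Qed.

(** Strings square to the identity and conjugation preserves this, so the scalar squares to 1. *)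
Lemma unitary_pauli_sign U (a : C) sigma tau : unitary U ->
  adjmx U *m pauli sigma *m U = a *: pauli tau -> a ^+ 2 = 1.
Proof.
move=> uU eq_a; have := unitary_conjM (pauli sigma) (pauli sigma) uU.
rewrite pauli_sqr mulmx1 unitaryVl // eq_a -scalemxAl -scalemxAr pauli_sqr scalerA.
by rewrite -(pauli_pid C n) -[RHS]scale1r => /scale_pauli_inj.
Qed.

Lemma clifford_pauli U sigma : clifford U ->
  exists (b : bool) tau, adjmx U *m pauli sigma *m U = (-1) ^+ b *: pauli tau.
Proof.
move=> [uU cU].
have [|k [tau eqU]] := (cU (adjmx U *m pauli sigma *m U)).2.
  by exists 0%N, sigma; rewrite scale1r !mulmxA uU mul1mx -mulmxA uU mulmx1.
have /eqP := unitary_pauli_sign uU eqU; rewrite sqrf_eq1 eqU => /orP[] /eqP ->.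
  by exists false, tau.
by exists true, tau.
Qed.

(** The label of [U^+ P U], with its sign forgotten. The default [pid] is a junk value, never
    reached when [U] is Clifford (see [cactP]). *)
Definition cact U sigma : pstring n :=
  odflt pid [pick tau | [exists b : bool,
    adjmx U *m pauli sigma *m U == (-1) ^+ b *: pauli tau]].

Lemma cactP U sigma : clifford U ->
  exists b : bool, adjmx U *m pauli sigma *m U = (-1) ^+ b *: pauli (cact U sigma).
Proof.
move=> cU; rewrite /cact; case: pickP => [tau /existsP[b /eqP ->]|]; first by exists b.
have [b [tau eqU]] := clifford_pauli sigma cU; move/(_ tau)/existsP => [].
by exists b; rewrite eqU.
Qed.

Lemma unitary_conj_inj U A B : unitary U ->
  adjmx U *m A *m U = adjmx U *m B *m U -> A = B.
Proof.
move=> uU eqAB; have conjK X : U *m (adjmx U *m X *m U) *m adjmx U = X.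
  by rewrite !mulmxA uU mul1mx -mulmxA uU mulmx1.
by rewrite -(conjK A) eqAB conjK.
Qed.

Lemma cact_inj U : clifford U -> injective (cact U).
Proof.
move=> cU sigma tau eq_st; have uU := clifford_unitary cU.
have [b bE] := cactP sigma cU; have [b' bE'] := cactP tau cU.
apply: (@pauli_inj C n ((-1) ^+ b * (-1) ^+ b')).
apply: (unitary_conj_inj uU); rewrite bE -scalemxAr -scalemxAl bE' eq_st.
by rewrite scalerA -mulrA -expr2 sqrr_sign mulr1.
Qed.

Lemma cact_pid U : clifford U -> cact U pid = pid.
Proof.
move=> cU; have uU := clifford_unitary cU; have [b] := cactP pid cU.
rewrite pauli_pid mulmx1 unitaryVl // -(pauli_pid C n) => eq_pid.
exact/esym/(pauli_inj eq_pid).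
Qed.

(** Conjugation preserves the commutation relation between two strings, and the signs from [cactP]
    occur on both sides and cancel. *)
Lemma chi_cact U sigma tau : clifford U -> chi (cact U sigma) (cact U tau) = chi sigma tau.
Proof.
move=> cU; have uU := clifford_unitary cU.
have [b bE] := cactP sigma cU; have [b' bE'] := cactP tau cU.
have := unitary_conjM (pauli sigma) (pauli tau) uU; rewrite (pauli_comm C sigma tau).
rewrite -scalemxAr -[RHS]scalemxAl -unitary_conjM // bE bE'.
rewrite -!scalemxAl -!scalemxAr !scalerA pauli_comm pauliM !scalerA => /scale_pauli_inj.
set e := _ ^+ b; set e' := _ ^+ b'; set k := 'i ^+ _ => eq_chi.
have nz : e * e' * k != 0 by rewrite !mulf_neq0 ?signr_eq0 // expf_neq0 ?neq0Ci.
by apply: (mulfI nz); rewrite mulrAC eq_chi; ring.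
Qed.

End CliffordAction.

(** * Sums over a transversal of the Clifford group *)

Section Averaging.
Variables (C : numClosedFieldType) (n : nat) (s : seq 'M[C]_(2 ^ n)).
Hypothesis sP : clifford_transversal s.
Implicit Types (sigma tau mu : pstring n) (U V : 'M[C]_(2 ^ n)).

Lemma transversal_size_neq0 : (size s)%:R != 0 :> C.
Proof.
have [|i _] := sP.2 1%:M.
  split=> [|M]; first by rewrite /unitary adjmx1 mulmx1.
  by rewrite adjmx1 mulmx1 mul1mx.
by rewrite pnatr_eq0; rewrite -lt0n (leq_trans _ (ltn_ord i)).
Qed.

(** Left multiplication by [V] permutes the phase classes. It sends an entry of [s] to another entry
    only up to a phase, hence the invariance asked of [h]. *)
Lemma transversal_sum_mull V (h : 'M[C]_(2 ^ n) -> C) : clifford V ->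
  (forall c U, `|c| = 1 -> h (c *: U) = h U) ->
  \sum_(U <- s) h (V *m U) = \sum_(U <- s) h U.
Proof.
move=> cV hZ; rewrite [LHS](big_nth 0) [RHS](big_nth 0) !big_mkord.
have cs (i : 'I_(size s)) : clifford s`_i by apply: sP.1; rewrite mem_nth.
have /fin_all_exists[p pP] (i : 'I_(size s)) :
    exists j : 'I_(size s), phase_equiv (V *m s`_i) s`_j.
  by have [j [jP _]] := sP.2 _ (cliffordM cV (cs i)); exists j.
have p_inj : injective p.
  move=> i j eq_p; have [c [c1 cE]] := pP i; have [c' [c1' cE']] := pP j.
  have c'0 : c' != 0 by rewrite -normr_eq0 c1' oner_neq0.
  have [k [_ kU]] := sP.2 _ (cs i).
  (* Cancelling [V] in [p i = p j] makes [s_i] and [s_j] phase-equivalent, and the index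
     representing a class is unique. *)
  rewrite -(kU i); last by exists 1; rewrite normr1 scale1r.
  apply: kU; exists (c'^-1 * c); rewrite normrM normfV c1 c1' invr1 mulr1; split=> //.
  have uV := unitaryVl (clifford_unitary cV).
  rewrite -scalerA -[s`_i]mul1mx -uV -mulmxA scalemxAr -cE eq_p cE'.
  by rewrite -scalemxAr scalerA mulVf // scale1r mulmxA uV mul1mx.
rewrite [RHS](reindex_inj p_inj) /=; apply: eq_bigr => i _.
by have [c [c1 ->]] := pP i; rewrite hZ.
Qed.

Variable f : 'M[C]_(2 ^ n) -> 'M[C]_(2 ^ n) -> C.
Hypothesis f_sign : forall (a b : C) A B, a ^+ 2 = 1 -> b ^+ 2 = 1 ->
  f (a *: A) (b *: B) = f A B.

(** The Clifford average of [f] on the conjugated pair, without the normalisation by [size s]. *)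
Definition orbit_sum sigma tau : C :=
  \sum_(U <- s) f (adjmx U *m pauli sigma *m U) (adjmx U *m pauli tau *m U).

Lemma orbit_sum_tv mu sigma tau :
  orbit_sum (tv C mu sigma) (tv C mu tau) = orbit_sum sigma tau.
Proof.
(* With [- 'i] the adjoint of [V] is [tvmx 'i mu], so conjugation by [V^+] is the case [c = 'i] of
   [tvmx_conj]. *)
pose V : 'M[C]_(2 ^ n) := tvmx (- 'i) mu.
have c2 : (- 'i) ^+ 2 = -1 :> C by rewrite sqrrN sqrCi.
have cV : clifford V by apply: clifford_tvmx.
have uV := clifford_unitary cV.
have VP rho : exists2 a : C, a ^+ 2 = 1 &
    adjmx V *m pauli rho *m V = a *: pauli (tv C mu rho).
  suff [a aE] : exists a : C, adjmx V *m pauli rho *m V = a *: pauli (tv C mu rho).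
    by exists a => //; apply: unitary_pauli_sign aE.
  rewrite adj_tvmx // opprK tvmx_conj ?sqrCi // /tv; case: ifP => _.
    by exists 1; rewrite scale1r.
  by rewrite pauliM scalerA; eexists.
have [a a2 aE] := VP sigma; have [b b2 bE] := VP tau.
rewrite /orbit_sum -[RHS](transversal_sum_mull cV) => [|c U c1]; last first.
  have c1' : c^* * c = 1 by rewrite mulrC -normCK c1 expr1n.
  by rewrite adjmxZ -!scalemxAl -!scalemxAr !scalerA c1' !scale1r.
apply: eq_bigr => U _; rewrite adjmxM !mulmxA.
have conjV A : adjmx U *m adjmx V *m A *m V *m U = adjmx U *m (adjmx V *m A *m V) *m U.
  by rewrite !mulmxA.
by rewrite !conjV aE bE -!scalemxAr -!scalemxAl f_sign.
Qed.

(** For each fixed [U], relabelling both strings by the bijection [cact U] recovers the sum without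
    [U], so all entries of [s] contribute equally. *)
Lemma sum_orbit_sum (w : pstring n -> pstring n -> bool) :
  (forall U sigma tau, clifford U -> w (cact U sigma) (cact U tau) = w sigma tau) ->
  \sum_sigma \sum_(tau | w sigma tau) orbit_sum sigma tau =
  (size s)%:R * \sum_sigma \sum_(tau | w sigma tau) f (pauli sigma) (pauli tau).
Proof.
move=> w_inv; rewrite /orbit_sum.
under eq_bigr => sigma _ do rewrite exchange_big.
rewrite exchange_big /= mulr_natl -iter_addr_0 -(count_predT s) -big_const_seq.
apply: eq_big_seq => U /sP.1 cU; have c_inj := cact_inj cU.
rewrite [RHS](reindex_inj c_inj); apply: eq_bigr => sigma _.
rewrite [RHS](reindex_inj c_inj); apply: eq_big => tau; first by rewrite w_inv.
have [b ->] := cactP sigma cU; have [b' ->] := cactP tau cU.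
by rewrite f_sign ?sqrr_sign.
Qed.

End Averaging.

(** * Counting commuting pairs, among all strings and among diagonal ones *)

Section Counting.
Variables (C : numClosedFieldType) (n : nat).
Local Notation d := ((2 ^ n)%:R : C).
Local Notation chi := (chi C).
Implicit Types (sigma tau mu : pstring n).

Lemma card_pstring : \sum_(sigma : pstring n) 1 = d ^+ 2.
Proof.
have := sum_chi C (@pid n); rewrite eqxx mulr1 => <-.
by apply: eq_bigr => sigma _; rewrite chip1.
Qed.

Lemma sum_neq_pid : \sum_(sigma : pstring n) (sigma != pid)%:R = d ^+ 2 - 1.
Proof.
rewrite -card_pstring (bigD1 pid) //= eqxx add0r [in RHS](bigD1 pid) //= [1 + _]addrC addrK.
by apply: eq_bigr => sigma ->.
Qed.

(** The indicator of commutation is [(1 + chi) / 2]. The diagonal is subtracted, and [g pid = 0]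
    takes care of the pairs containing the identity. *)
Lemma sum_cpair (g : pstring n -> C) : g pid = 0 ->
  \sum_sigma \sum_(tau | cpair C sigma tau) g sigma * g tau =
  2^-1 * ((\sum_sigma g sigma) ^+ 2 + \sum_sigma \sum_tau chi sigma tau * g sigma * g tau)
  - \sum_sigma g sigma ^+ 2.
Proof.
move=> g0; rewrite expr2 mulr_suml -big_split mulr_sumr /= -sumrB; apply: eq_bigr => sigma _.
rewrite mulr_sumr -big_split mulr_sumr [in RHS](bigD1 sigma) //= chipp.
have -> : 2^-1 * (g sigma * g sigma + 1 * g sigma * g sigma) = g sigma ^+ 2.
  by field.
rewrite [g sigma ^+ 2 + _]addrC addrK big_mkcond [RHS]big_mkcond; apply: eq_bigr => tau _.
rewrite /cpair (eq_sym sigma tau).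
have [->|_] := eqVneq sigma pid; first by rewrite g0 !(mulr0, mul0r, addr0) if_same.
have [->|_] := eqVneq tau pid; first by rewrite g0 !(mulr0, mul0r, addr0) if_same.
have [//|_] := eqVneq tau sigma; have [->|/chi_neq1 ->] /= := eqVneq (chi sigma tau) 1.
  by field.
by rewrite mulN1r mulNr subrr mulr0.
Qed.

(** This is [sum_cpair] for the indicator of the non-identity strings; the factor 2 clears the
    half. *)
Lemma card_cpair :
  2 * (\sum_(sigma : pstring n) \sum_(tau | cpair C sigma tau) 1) =
  (d ^+ 2 - 1) * (d - 2) * (d + 2).
Proof.
pose g sigma : C := (sigma != pid)%:R.
have g2 sigma : g sigma ^+ 2 = g sigma by rewrite /g; case: eqP => _; rewrite ?expr1n ?expr0n.
transitivity (2 * (\sum_sigma \sum_(tau | cpair C sigma tau) g sigma * g tau)).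
  congr (_ * _); apply: eq_bigr => sigma _; apply: eq_bigr => tau /and4P[s1 t1 _ _].
  by rewrite /g s1 t1 mulr1.
rewrite sum_cpair ?/g ?eqxx // -/g.
rewrite [\sum_sigma g sigma ^+ 2](eq_bigr g) => [|sigma _]; last exact: g2.
rewrite sum_neq_pid.
have -> : \sum_sigma \sum_tau chi sigma tau * g sigma * g tau = - (d ^+ 2 - 1).
  rewrite -sum_neq_pid -sumrN; apply: eq_bigr => sigma _.
  (* A nontrivial character sums to zero over all strings, hence to -1 once [pid] is left out. *)
  transitivity (g sigma * ((\sum_tau chi tau sigma) - 1)).
    rewrite [in RHS](bigD1 pid) //= chi1p [1 + _]addrC addrK mulr_sumr [LHS](bigD1 pid) //=.
    rewrite {2}/g eqxx mulr0 add0r; apply: eq_bigr => tau t1.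
    by rewrite {2}/g t1 mulr1 mulrC chiC.
  by rewrite sum_chi /g; case: eqP => _; rewrite /= ?mulr0 ?sub0r ?mulrN1 // mul0r oppr0.
by field.
Qed.

(** Diagonal strings all commute, so two distinct non-identity ones always form a [cpair]. *)
Lemma sum_zstring_split (h : pstring n -> pstring n -> C) :
  (forall sigma, h pid sigma = 0) -> (forall sigma, h sigma pid = 0) ->
  \sum_(sigma | zstring sigma) \sum_(tau | zstring tau) h sigma tau =
  \sum_(sigma | zstring sigma && (sigma != pid)) h sigma sigma +
  \sum_(sigma | zstring sigma) \sum_(tau | zstring tau && cpair C sigma tau) h sigma tau.
Proof.
move=> hl hr.
transitivity (\sum_(sigma | zstring sigma) h sigma sigma +
    \sum_(sigma | zstring sigma) \sum_(tau | zstring tau && cpair C sigma tau) h sigma tau).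
  rewrite -big_split; apply: eq_bigr => sigma zs /=.
  rewrite (bigD1 sigma) //=; congr (_ + _); rewrite big_mkcond [RHS]big_mkcond.
  apply: eq_bigr => tau _; rewrite /cpair (eq_sym sigma tau).
  have [zt|] //= := boolP (zstring tau); rewrite zstring_chi // eqxx andbT.
  have [->|_] := eqVneq sigma pid; first by rewrite hl if_same.
  by have [->|_] := eqVneq tau pid; first by rewrite hr if_same.
by congr (_ + _); rewrite (bigD1 pid) ?zstring_pid //= hl add0r.
Qed.

Lemma card_zstring_neq_pid :
  \sum_(sigma : pstring n | zstring sigma && (sigma != pid)) 1 = d - 1.
Proof.
have <- : \sum_(sigma : pstring n | zstring sigma) 1 = d.
  by rewrite sumr_const; congr (_%:R); apply: card_zstring.
by rewrite [in RHS](bigD1 pid) ?zstring_pid //= [1 + _]addrC addrK.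
Qed.

Lemma card_zstring_cpair :
  \sum_(sigma : pstring n | zstring sigma) \sum_(tau | zstring tau && cpair C sigma tau) 1
  = (d - 1) * (d - 2).
Proof.
pose g sigma : C := (sigma != pid)%:R.
have g0 : g pid = 0 by rewrite /g eqxx.
have := @sum_zstring_split (fun sigma tau => g sigma * g tau).
rewrite g0 => /(_ (fun _ => mul0r _) (fun _ => mulr0 _)).
have gE : \sum_(sigma | zstring sigma) g sigma = d - 1.
  rewrite -card_zstring_neq_pid (bigD1 pid) ?zstring_pid //= g0 add0r.
  by apply: eq_bigr => sigma /andP[_]; rewrite /g => ->.
under eq_bigr => sigma _ do rewrite -mulr_sumr gE.
rewrite -mulr_suml gE.
rewrite [X in _ = X + _](eq_bigr (fun=> 1)) => [|sigma /andP[_ s1]]; last first.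
  by rewrite /g s1 mulr1.
rewrite card_zstring_neq_pid => /esym/(canRL (addKr _)) cardE.
(* All ordered pairs of non-identity diagonal strings, minus the equal ones. *)
transitivity (- (d - 1) + (d - 1) * (d - 1)); last by ring.
rewrite -cardE; apply: eq_bigr => sigma _; apply: eq_bigr => tau /andP[_ /and4P[s1 t1 _ _]].
by rewrite /g s1 t1 mulr1.
Qed.

End Counting.

(** * Orbit sums over diagonal strings in terms of sums over all strings *)

Section Moments.
Variables (C : numClosedFieldType) (n : nat) (s : seq 'M[C]_(2 ^ n)).
Local Notation d := ((2 ^ n)%:R : C).
Hypothesis sP : clifford_transversal s.
Implicit Types (sigma tau mu : pstring n) (U V : 'M[C]_(2 ^ n)).

Variable f : 'M[C]_(2 ^ n) -> 'M[C]_(2 ^ n) -> C.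
Hypothesis f_sign : forall (a b : C) A B, a ^+ 2 = 1 -> b ^+ 2 = 1 ->
  f (a *: A) (b *: B) = f A B.

Lemma dimD1_neq0 : d + 1 != 0. Proof. by rewrite natr1 pnatr_eq0. Qed.

(** The orbit sum is constant on the diagonal, where [d - 1] of the [d ^+ 2 - 1] non-identity
    strings are in [{I,Z}^n]; the ratio is [d + 1]. *)
Lemma sum_zstring_orbit_diag :
  (d + 1) * (\sum_(sigma | zstring sigma && (sigma != pid)) orbit_sum s f sigma sigma) =
  (size s)%:R * \sum_(sigma : pstring n | sigma != pid) f (pauli sigma) (pauli sigma).
Proof.
(* The diagonal is written as an invariant relation so that [sum_orbit_sum] applies. *)
pose w sigma tau := (sigma != pid) && (tau == sigma).
have diag (h : pstring n -> pstring n -> C) :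
    \sum_sigma \sum_(tau | w sigma tau) h sigma tau = \sum_(sigma | sigma != pid) h sigma sigma.
  rewrite [RHS]big_mkcond; apply: eq_bigr => sigma _; rewrite /w; case: ifP => _ /=.
    by rewrite big_pred1_eq.
  by rewrite big_pred0.
have := sum_orbit_sum sP f_sign (w := w); rewrite !diag => <-; last first.
  move=> U sigma tau cU; have c_inj := cact_inj cU.
  by rewrite /w -{1}(cact_pid cU) !(inj_eq c_inj).
have Kconst := tv_invariant_diag (orbit_sum_tv sP f_sign).
have [k kE] : exists k, forall sigma, sigma != pid -> orbit_sum s f sigma sigma = k.
  have [sigma s1|all1] := pickP (fun sigma : pstring n => sigma != pid).
    by exists (orbit_sum s f sigma sigma) => tau t1; apply: Kconst.
  by exists 0 => sigma; rewrite all1.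
rewrite (eq_bigr (fun=> k * 1)) => [|sigma /andP[_ /kE ->]]; last by rewrite mulr1.
rewrite [RHS](eq_bigr (fun sigma => k * (sigma != pid)%:R)); last first.
  by move=> sigma s1; rewrite kE // s1 mulr1.
rewrite -!mulr_sumr card_zstring_neq_pid.
have -> : \sum_(sigma : pstring n | sigma != pid) (sigma != pid)%:R = d ^+ 2 - 1.
  by rewrite -sum_neq_pid [RHS](bigD1 pid) //= eqxx add0r.
by ring.
Qed.

(** The orbit sum is constant on commuting pairs, and the factors compare the two counts
    [(d - 1) (d - 2)] and [(d ^+ 2 - 1) (d ^+ 2 - 4) / 2]. *)
Lemma sum_zstring_orbit_cpair :
  (d + 1) * (d + 2) * (\sum_(sigma | zstring sigma)
     \sum_(tau | zstring tau && cpair C sigma tau) orbit_sum s f sigma tau) =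
  2 * (size s)%:R *
    \sum_(sigma : pstring n) \sum_(tau | cpair C sigma tau) f (pauli sigma) (pauli tau).
Proof.
rewrite -[RHS]mulrA -(sum_orbit_sum sP f_sign) => [|U sigma tau cU]; last first.
  have c_inj := cact_inj cU; rewrite /cpair chi_cact // (inj_eq c_inj).
  by rewrite -{1 2}(cact_pid cU) !(inj_eq c_inj).
have Kconst := tv_invariant_cpair (orbit_sum_tv sP f_sign).
have [k kE] : exists k, forall sigma tau, cpair C sigma tau -> orbit_sum s f sigma tau = k.
  have [[sigma sigma'] /= css|none] := pickP (fun p : pstring n * pstring n => cpair C p.1 p.2).
    by exists (orbit_sum s f sigma sigma') => tau tau' ctt; apply: Kconst.
  (* No commuting pair exists, as for one qubit, so any constant will do. *)
  by exists 0 => sigma tau; have /= -> := none (sigma, tau).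
transitivity ((d + 1) * (d + 2) * (k *
    \sum_(sigma : pstring n | zstring sigma) \sum_(tau | zstring tau && cpair C sigma tau) 1)).
  congr (_ * _); rewrite mulr_sumr; apply: eq_bigr => sigma _; rewrite mulr_sumr.
  by apply: eq_bigr => tau /andP[_ /kE ->]; rewrite mulr1.
transitivity (2 * (k * \sum_(sigma : pstring n) \sum_(tau | cpair C sigma tau) 1)).
  by rewrite [RHS]mulrCA card_cpair card_zstring_cpair; ring.
congr (_ * _); rewrite mulr_sumr; apply: eq_bigr => sigma _; rewrite mulr_sumr.
by apply: eq_bigr => tau /kE ->; rewrite mulr1.
Qed.

End Moments.

(** * Fourier duality of [Xi2] and [tXi2], and the norm bounds *)

Section Xi.
Variables (C : numClosedFieldType) (n : nat).
Local Notation d := ((2 ^ n)%:R : C).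
Local Notation chi := (chi C).
Implicit Types (sigma tau : pstring n) (A B rho : 'M[C]_(2 ^ n)).

Lemma sum_Xi2 A B : \sum_sigma Xi2 A B sigma = d * \tr (A *m B).
Proof. exact: sum_mxtrace_pauli2. Qed.

Lemma pauli_conj sigma tau :
  pauli sigma *m pauli tau *m pauli sigma = chi sigma tau *: pauli tau :> 'M[C]_(2 ^ n).
Proof. by rewrite pauli_comm -scalemxAl -mulmxA pauli_sqr mulmx1. Qed.

(* [tXi2] is, up to the factor [d], the symplectic Fourier transform of [Xi2]. *)
Lemma sum_chi_Xi2 A B sigma :
  \sum_tau chi sigma tau * Xi2 A B tau = d * tXi2 A B sigma.
Proof.
rewrite /tXi2 -!mulmxA -sum_mxtrace_pauli2; apply: eq_bigr => tau _.
rewrite /Xi2 mulrCA; congr (_ * _).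
rewrite -mxtraceZ scalemxAr -pauli_conj mulmxA [in LHS]mulmxA.
by rewrite mxtrace_mulC !mulmxA.
Qed.

(** Parseval's identity: after expanding the squares, summing over [sigma] first leaves only
    [mu = tau]. *)
Lemma sum_tXi2_sqr A B : \sum_sigma tXi2 A B sigma ^+ 2 = \sum_sigma Xi2 A B sigma ^+ 2.
Proof.
have d2 : d ^+ 2 != 0 by rewrite expf_neq0 // dim_neq0.
apply: (mulfI d2); rewrite mulr_sumr.
transitivity (\sum_sigma \sum_tau \sum_mu
    Xi2 A B tau * Xi2 A B mu * chi sigma (pmul tau mu)).
  apply: eq_bigr => sigma _; rewrite -exprMn -sum_chi_Xi2 expr2 mulr_suml.
  apply: eq_bigr => tau _; rewrite mulr_sumr; apply: eq_bigr => mu _.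
  by rewrite chiM; ring.
rewrite exchange_big mulr_sumr; apply: eq_bigr => tau _ /=.
rewrite exchange_big (bigD1 tau) //= [X in _ + X]big1 => [|mu neq_mt].
  by rewrite -mulr_sumr sum_chi pmulpp eqxx addr0 mulr1 mulrC expr2.
by rewrite -mulr_sumr sum_chi pmul_eq pmulp1 (negPf neq_mt) !mulr0.
Qed.

Lemma conj_Xi2 A B sigma : herm_op A -> herm_op B -> (Xi2 A B sigma)^* = Xi2 A B sigma.
Proof.
by move=> hA hB; rewrite rmorphM /= !herm_mxtrace_real //; apply: adjmx_pauli.
Qed.

Lemma conj_tXi2 A B sigma : herm_op A -> herm_op B -> (tXi2 A B sigma)^* = tXi2 A B sigma.
Proof.
move=> hA hB; apply: (mulfI (dim_neq0 C n)).
rewrite -[d in LHS]conjC_nat -rmorphM /= -sum_chi_Xi2 rmorph_sum; apply: eq_bigr => tau _.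
rewrite rmorphM /= conj_Xi2 //; congr (_ * _).
by have [->|/chi_neq1 ->] := eqVneq (chi sigma tau) 1; rewrite ?rmorphN rmorph1.
Qed.

Lemma l2sq_Xi2 A B : herm_op A -> herm_op B ->
  l2sq (Xi2 A B) = \sum_sigma Xi2 A B sigma ^+ 2.
Proof.
by move=> hA hB; apply: eq_bigr => sigma _; rewrite normCK conj_Xi2 // expr2.
Qed.

(** Both functions are real with the same norm, so twice the gap is the sum of the squares of their
    differences. *)
Lemma vdot_tXi2_le A B : herm_op A -> herm_op B -> vdot (tXi2 A B) (Xi2 A B) <= l2sq (Xi2 A B).
Proof.
move=> hA hB; rewrite l2sq_Xi2 // -(ler_pM2l (ltr0n C 2)) -subr_ge0.
have -> : 2 * (\sum_sigma Xi2 A B sigma ^+ 2) - 2 * vdot (tXi2 A B) (Xi2 A B)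
    = \sum_sigma (Xi2 A B sigma - tXi2 A B sigma) ^+ 2.
  rewrite mulr_natl mulr2n -{2}sum_tXi2_sqr mulr_sumr -big_split -sumrB.
  by apply: eq_bigr => sigma _ /=; ring.
apply: sumr_ge0 => sigma _; rewrite real_exprn_even_ge0 //.
by apply/CrealP; rewrite rmorphB /= conj_Xi2 ?conj_tXi2.
Qed.

Lemma hs2E A : herm_op A -> hs2 A = \tr (A *m A).
Proof.
move=> hA; apply: eq_bigr => i _; rewrite mxE; apply: eq_bigr => j _.
by rewrite -{3}hA mxE normCK.
Qed.

Lemma psd_mxtrace_ge0 rho A : psd rho -> herm_op A -> 0 <= \tr (A *m rho *m A).
Proof.
move=> psd_rho hA; apply: sumr_ge0 => i _.
have -> : (A *m rho *m A) i i = ((\row_k (col i A k 0)^*) *m rho *m col i A) 0 0.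
  rewrite [LHS]mxE [RHS]mxE; apply: eq_bigr => k _; rewrite [col i A k 0]mxE; congr (_ * _).
  rewrite [LHS]mxE [RHS]mxE; apply: eq_bigr => l _; congr (_ * _).
  by rewrite !mxE -{1}hA mxE.
exact: psd_rho.
Qed.

(** For a sign [e], the Hermitian [A = 1 + e P] satisfies [A A = 2 A]. Positivity of [tr (A rho A)]
    then gives [0 <= 1 + e t], and the cases [e = 1] and [e = -1] multiply to [0 <= 1 - t ^+ 2]. *)
Lemma density_pauli_sqr_le1 rho sigma : density rho -> (\tr (rho *m pauli sigma)) ^+ 2 <= 1.
Proof.
move=> [h_rho [psd_rho tr_rho]]; set t := \tr _.
have pos (e : C) : e ^+ 2 = 1 -> e^* = e -> 0 <= 1 + e * t.
  move=> e2 eR; rewrite -(pmulr_rge0 _ (ltr0n C 2)).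
  have hP : herm_op (1%:M + e *: pauli sigma : 'M[C]_(2 ^ n)).
    by rewrite /herm_op adjmxD adjmx1 adjmxZ adjmx_pauli eR.
  have := psd_mxtrace_ge0 psd_rho hP; set A := 1%:M + _.
  have -> : \tr (A *m rho *m A) = \tr (rho *m (A *m A)) by rewrite -mulmxA mxtrace_mulC mulmxA.
  have -> : A *m A = 2 *: A.
    rewrite {1}/A mulmxDl mul1mx -scalemxAl {2}/A mulmxDr mulmx1 -scalemxAr pauli_sqr.
    by rewrite scalerDr scalerA -expr2 e2 scale1r [e *: _ + _]addrC -mulr2n scaler_nat.
  by rewrite -scalemxAr mxtraceZ mulmxDr mxtraceD mulmx1 tr_rho -scalemxAr mxtraceZ.
have pos1 : 0 <= 1 + t by rewrite -[t]mul1r pos ?expr1n ?rmorph1.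
have posN1 : 0 <= 1 - t by rewrite -mulN1r pos ?sqrrN ?expr1n ?rmorphN1.
by rewrite -subr_ge0 -[X in X - _](expr1n _ 2) subr_sqr mulr_ge0.
Qed.

(** The factors from [rho] are at most 1, and the remaining sum is evaluated by the Pauli form of
    Parseval's identity. *)
Lemma l2sq_Xi2_le rho A : density rho -> herm_op A -> l2sq (Xi2 rho A) <= d * hs2 A.
Proof.
move=> d_rho hA; have [h_rho _] := d_rho; rewrite l2sq_Xi2 // hs2E // -sum_mxtrace_pauli2.
apply: ler_sum => sigma _; rewrite exprMn -expr2 ler_piMl ?density_pauli_sqr_le1 //.
rewrite real_exprn_even_ge0 //; apply/CrealP; rewrite herm_mxtrace_real //.
exact: adjmx_pauli.
Qed.

End Xi.

(** * The measurement channel and the exact formula for [Vstar] *)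

Section Main.
Variables (C : numClosedFieldType) (n : nat) (s : seq 'M[C]_(2 ^ n)).
Local Notation d := ((2 ^ n)%:R : C).
Local Notation chi := (chi C).
Hypothesis sP : clifford_transversal s.
Implicit Types (sigma tau : pstring n) (A B X U rho O : 'M[C]_(2 ^ n)).

Lemma mxtrace_conj U X A : \tr ((U *m X *m adjmx U) *m A) = \tr (X *m (adjmx U *m A *m U)).
Proof. by rewrite -!mulmxA mxtrace_mulC !mulmxA. Qed.

(** Dephasing of [U X U^+], with the conjugation moved onto the strings. *)
Lemma diag_dephase U X : unitary U ->
  d *: (\sum_b ((U *m X *m adjmx U) b b) *: (adjmx U *m delta_mx b b *m U)) =
  \sum_(sigma | zstring sigma)
     \tr (X *m (adjmx U *m pauli sigma *m U)) *: (adjmx U *m pauli sigma *m U).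
Proof.
move=> uU.
transitivity (adjmx U *m (\sum_(sigma | zstring sigma)
    \tr ((U *m X *m adjmx U) *m pauli sigma) *: pauli sigma) *m U).
  rewrite sum_zstring_mxtrace -scalemxAr -scalemxAl mulmx_sumr mulmx_suml; congr (_ *: _).
  by apply: eq_bigr => b _; rewrite -scalemxAr -scalemxAl.
rewrite mulmx_sumr mulmx_suml; apply: eq_bigr => sigma _.
by rewrite -scalemxAr -scalemxAl mxtrace_conj.
Qed.

(** Entry by entry, [d] times the channel is the average of [tr (X P) P] over conjugates [P] of
    diagonal strings. The identity is fixed by conjugation; the other strings are handled by
    [sum_zstring_orbit_diag] and completeness. *)
Lemma meas_channelE X : (d + 1) *: meas_channel s X = X + \tr X *: 1%:M.
Proof.
apply/matrixP => i j.
pose f A B := \tr (X *m A) * A i j.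
have f_sign (a b : C) A B : a ^+ 2 = 1 -> b ^+ 2 = 1 -> f (a *: A) (b *: B) = f A B.
  by move=> a2 _; rewrite /f -scalemxAr mxtraceZ mxE mulrACA -expr2 a2 mul1r.
have sN := transversal_size_neq0 sP.
have dM : d * (size s)%:R * meas_channel s X i j =
    \sum_(sigma | zstring sigma) orbit_sum s f sigma sigma.
  rewrite /meas_channel /expectM mxE -mulrA (mulVKf sN) summxE mulr_sumr /orbit_sum.
  rewrite exchange_big; apply: eq_big_seq => U /sP.1/clifford_unitary uU.
  have /matrixP/(_ i j) := diag_dephase X uU; rewrite mxE => ->.
  by rewrite summxE; apply: eq_bigr => sigma _; rewrite mxE.
have diag := sum_zstring_orbit_diag sP f_sign.
have sumP : \sum_(sigma : pstring n | sigma != pid) f (pauli sigma) (pauli sigma) =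
    d * X i j - \tr X * (i == j)%:R.
  have /matrixP/(_ i j) := sum_pauli_mxtrace X; rewrite summxE !mxE => <-.
  rewrite [in RHS](bigD1 pid) //= pauli_pid !mxE mulmx1 [X in _ = X - _]addrC addrK.
  by apply: eq_bigr => sigma _; rewrite /f [RHS]mxE.
have K1 : orbit_sum s f pid pid = (size s)%:R * (\tr X * (i == j)%:R).
  rewrite /orbit_sum mulr_natl -iter_addr_0 -(count_predT s) -big_const_seq.
  apply: eq_big_seq => U /sP.1/clifford_unitary uU.
  by rewrite /f pauli_pid mulmx1 unitaryVl // mulmx1 mxE.
rewrite (bigD1 pid) ?zstring_pid //= K1 in dM.
rewrite sumP in diag; rewrite [LHS]mxE [RHS]mxE [(_ *: 1%:M) i j]mxE [1%:M i j]mxE.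
apply: (mulfI (mulf_neq0 (dim_neq0 C n) sN)).
rewrite mulrCA dM mulrDr diag; ring.
Qed.

(** The square of a sum over diagonal strings is a double sum of orbit sums, which splits into its
    diagonal [K1] and its commuting pairs [K2]; each is then evaluated by its moment identity. *)
Lemma VstarE rho O : herm_op rho -> herm_op O -> \tr O = 0 ->
  Vstar s O rho = Vtri O rho - \tr (O *m rho) ^+ 2 / (d + 2).
Proof.
move=> h_rho hO trO.
pose g A := \tr (rho *m A) * \tr (O *m A); pose f A B := g A * g B.
have g_sign (a : C) A : a ^+ 2 = 1 -> g (a *: A) = g A.
  by move=> a2; rewrite /g -!scalemxAr !mxtraceZ mulrACA -expr2 a2 mul1r.
have f_sign (a b : C) A B : a ^+ 2 = 1 -> b ^+ 2 = 1 -> f (a *: A) (b *: B) = f A B.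
  by move=> a2 b2; rewrite /f !g_sign.
(* Tracelessness of [O] removes every term that contains the identity string. *)
have g1 : g 1%:M = 0 by rewrite /g !mulmx1 trO mulr0.
have sN := transversal_size_neq0 sP; have d0 := dim_neq0 C n.
have d1 : d + 1 != 0 by apply: dimD1_neq0.
have d2 : d + 2 != 0 by rewrite -natrD pnatr_eq0 addn2.
pose K := orbit_sum s f.
have gU U : unitary U -> g (adjmx U *m pauli pid *m U) = 0.
  by move=> uU; rewrite pauli_pid mulmx1 unitaryVl.
have [Kl Kr] : (forall sigma, K pid sigma = 0) /\ (forall sigma, K sigma pid = 0).
  by split=> sigma; apply: big1_seq => U /andP[_ /sP.1/clifford_unitary uU];
    rewrite /f gU // ?mul0r ?mulr0.
have := sum_zstring_split Kl Kr.
set KZ := (X in X = _); set K1 := (X in X + _); set K2 := (X in _ + X) => KE.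
have K1E : (d + 1) * K1 = (size s)%:R * \sum_sigma Xi2 rho O sigma ^+ 2.
  rewrite sum_zstring_orbit_diag // [in RHS](bigD1 pid) //=.
  rewrite [Xi2 _ _ pid](_ : _ = 0) ?expr0n ?add0r; last by rewrite /Xi2 pauli_pid.
  by congr (_ * _); apply: eq_bigr => sigma _; rewrite expr2.
have K2E : (d + 1) * (d + 2) * K2 = 2 * (size s)%:R *
    (2^-1 * ((d * \tr (O *m rho)) ^+ 2 + d * vdot (tXi2 rho O) (Xi2 rho O))
     - \sum_sigma Xi2 rho O sigma ^+ 2).
  rewrite sum_zstring_orbit_cpair // /f (sum_cpair (g := Xi2 rho O)) => [|]; last first.
    by rewrite /Xi2 pauli_pid.
  rewrite sum_Xi2 mxtrace_mulC; congr (_ * (_ * (_ + _) - _)).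
  rewrite mulr_sumr; apply: eq_bigr => sigma _; rewrite mulrA -sum_chi_Xi2 mulr_suml.
  by apply: eq_bigr => tau _; rewrite mulrAC.
(* The factor [d] comes from dephasing and [d + 1] from [minv2]; both are squared with the
   estimator. *)
have sumU : d ^+ 2 * (\sum_(U <- s) (\sum_b (U *m rho *m adjmx U) b b *
    (U *m minv2 O *m adjmx U) b b) ^+ 2) = (d + 1) ^+ 2 * KZ.
  rewrite /KZ /K /orbit_sum.
  under [in RHS]eq_bigr => sigma _ do rewrite exchange_big.
  rewrite exchange_big !mulr_sumr /=; apply: eq_big_seq => U /sP.1/clifford_unitary uU.
  rewrite -exprMn; transitivity (((d + 1) *
      \sum_(sigma | zstring sigma) g (adjmx U *m pauli sigma *m U)) ^+ 2).
    congr (_ ^+ 2).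
    transitivity ((d + 1) * (d * \sum_b (U *m rho *m adjmx U) b b * (U *m O *m adjmx U) b b)).
      rewrite mulrCA; congr (_ * _); rewrite mulr_sumr; apply: eq_bigr => b _.
      rewrite /minv2 trO scale0r subr0 -scalemxAr -scalemxAl [X in _ * X = _]mxE -natr1.
      by rewrite mulrCA.
    rewrite -sum_zstring_mxtrace2; congr (_ * _); apply: eq_bigr => sigma _.
    by rewrite !mxtrace_conj.
  rewrite exprMn [X in _ * X = _]expr2 mulr_suml; congr (_ * _); apply: eq_bigr => sigma _.
  by rewrite mulr_sumr.
rewrite /Vstar /expect /Vtri l2sq_Xi2 //.
have -> : \sum_(U <- s) (\sum_b (U *m rho *m adjmx U) b b *
    (U *m minv2 O *m adjmx U) b b) ^+ 2 = (d ^+ 2)^-1 * ((d + 1) ^+ 2 * (K1 + K2)).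
  by rewrite -KE -sumU mulKf // expf_neq0.
have -> : K1 = (d + 1)^-1 * ((size s)%:R * \sum_sigma Xi2 rho O sigma ^+ 2).
  by rewrite -K1E mulKf.
have -> : K2 = ((d + 1) * (d + 2))^-1 * (2 * (size s)%:R *
    (2^-1 * ((d * \tr (O *m rho)) ^+ 2 + d * vdot (tXi2 rho O) (Xi2 rho O))
     - \sum_sigma Xi2 rho O sigma ^+ 2)).
  by rewrite -K2E mulKf // mulf_neq0.
rewrite -[(2 ^ n).+2]addn2 -[(2 ^ n).+1]addn1 !natrD.
by field; rewrite sN d0 d1 d2.
Qed.

End Main.

Theorem theorem3 (C : numClosedFieldType) (n : nat) (s : seq 'M[C]_(2 ^ n))
    (rho O : 'M[C]_(2 ^ n)) :
  (1 <= n)%N ->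
  clifford_transversal s ->
  density rho ->
  herm_op O -> \tr O = 0 ->
  (* for the Clifford ensemble, the 2-design formula is indeed M^{-1}(O) *)
  (meas_channel s (minv2 O) = O /\
   (forall X, meas_channel s X = O -> X = minv2 O)) /\
  Vstar s O rho = Vtri O rho - (\tr (O *m rho)) ^+ 2 / ((2 ^ n).+2)%:R /\
  Vtri O rho - (\tr (O *m rho)) ^+ 2 / ((2 ^ n).+2)%:R <= Vtri O rho /\
  Vtri O rho <= (2 * (2 ^ n).+1)%:R / ((2 ^ n)%:R * ((2 ^ n).+2)%:R)
                * l2sq (Xi2 rho O) /\
  (2 * (2 ^ n).+1)%:R / ((2 ^ n)%:R * ((2 ^ n).+2)%:R) * l2sq (Xi2 rho O)
    <= (2 * (2 ^ n).+1)%:R / ((2 ^ n).+2)%:R * hs2 O.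
Proof.
move=> _ sP d_rho hO trO; have [h_rho _] := d_rho.
have d1 : (2 ^ n)%:R + 1 != 0 :> C := dimD1_neq0 C n.
have minv2E : minv2 O = ((2 ^ n)%:R + 1) *: O by rewrite /minv2 trO scale0r subr0 natr1.
split; first split.
- apply: (scalerI d1); rewrite (meas_channelE sP) minv2E mxtraceZ trO mulr0.
  by rewrite scale0r addr0.
(* Taking traces in [(d + 1) O = X + tr X 1] gives [(d + 1) tr X = 0], so [X] is traceless and
   equals [(d + 1) O]. *)
- move=> X MX; have := meas_channelE sP X; rewrite MX minv2E => OX.
  have := congr1 mxtrace OX; rewrite mxtraceZ trO mulr0 mxtraceD mxtraceZ mxtrace1.
  rewrite -[X in X + _]mulr1 -mulrDr [1 + _]addrC => /esym/eqP.
  rewrite mulf_eq0 (negPf d1) orbF => /eqP trX.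
  by rewrite OX trX scale0r addr0.
split; first by rewrite VstarE // -natrD addn2.
split.
  (* The subtracted term is nonnegative because [tr (O rho)] is real. *)
  rewrite gerBl divr_ge0 ?ler0n // real_exprn_even_ge0 //.
  by apply/CrealP/herm_mxtrace_real.
have c_ge0 : 0 <= (2 ^ n).+1%:R / ((2 ^ n)%:R * (2 ^ n).+2%:R) :> C.
  by rewrite divr_ge0 // -?natrM ler0n.
split.
  rewrite /Vtri [X in _ <= X](_ : _ = (2 ^ n).+1%:R / ((2 ^ n)%:R * (2 ^ n).+2%:R) *
    (2 * l2sq (Xi2 rho O))); last by rewrite natrM; ring.
  rewrite ler_wpM2l //.
  by rewrite mulr_natl mulr2n lerD2l vdot_tXi2_le.
apply: le_trans (ler_wpM2l _ (l2sq_Xi2_le d_rho hO)) _.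
  by rewrite divr_ge0 // -?natrM ler0n.
suff -> : (2 * (2 ^ n).+1)%:R / ((2 ^ n)%:R * (2 ^ n).+2%:R) * ((2 ^ n)%:R * hs2 O)
  = (2 * (2 ^ n).+1)%:R / (2 ^ n).+2%:R * hs2 O :> C by [].
by rewrite invfM [(2 ^ n)%:R^-1 * _]mulrC -!mulrA mulKf // dim_neq0.
Qed.
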